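(* Let $k$ be an integer. There are infinitely many integers in $C_k$ with exactly two prime factors if and only if $k>0$ and $k$ is prime. Moreover: (1) for any integer $k$, there are only finitely many elements of $C_k$ of the form $pq$ with $p\neq q$ primes both coprime to $k$; (2) if $k<0$, or if $k>0$ and $k$ is not prime, then there are only finitely many elements of $C_k$ with exactly two prime factors at least one of which divides $k$.
   Context: For an integer $k$, $C_k$ denotes the set of integers $n>\max(k,0)$ such that $a^{n-k+1}\equiv a \pmod{n}$ for all integers $a$. *)

(* Defs.v *)
From HB Require Import structures.
From mathcomp Require Import all_boot all_order all_algebra.
From mathcomp Require Import boolp classical_sets functions cardinality.

Set Implicit Arguments.
Unset Strict Implicit.
Unset Printing Implicit Defensive.

Import Order.TTheory GRing.Theory Num.Theory.

Local Open Scope ring_scope.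
Local Open Scope classical_set_scope.

(* The exponent is an [int], positive (even at least 2) because [k < n]; so no
   inverse is ever taken, and [C k] contains only squarefree integers. *)
Definition C (k : int) : set int :=
  [set n : int | (Num.max k 0 < n) /\
     forall a : int, (a ^ (n - k + 1) = a %[mod n])%Z].

(* Distinct prime factors; counting them with multiplicity would make no
   difference on [C k], whose elements are squarefree. *)
Definition two_prime_factors : set int :=
  [set n : int | size (primes `|n|%N) = 2%N].

(* Main.v *)
(* Elements of [C k] are squarefree, and a prime [p] dividing [n] in [C k]
   satisfies [p - 1 | n - k], by a primitive root modulo [p].  So if [p q] is in
   [C k] with [p < q], then [q - 1 | p - k] and [p - 1 | q - k]; unless [p = k],
   these bound [q] linearly in [|k|].  When [k] is prime, conversely, [k q] is in
   [C k] for every prime [q > k] with [q = 1] modulo [k - 1]; there are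
   infinitely many of these because every prime divisor of [Phi_m(a)] not
   dividing [m] is [1] modulo [m], and [a] may be a multiple of [N!]. *)
Require Import Defs.
From mathcomp Require Import all_boot all_order all_algebra.
From mathcomp Require Import cyclic cyclotomic finfield.
From mathcomp Require Import boolp classical_sets functions cardinality.
From mathcomp Require Import zify.

Set Implicit Arguments.
Unset Strict Implicit.
Unset Printing Implicit Defensive.

Import Order.TTheory GRing.Theory Num.Theory.

Local Open Scope ring_scope.
Local Open Scope classical_set_scope.

(** * Roots of unity in prime fields and roots of cyclotomic polynomials *)

Lemma expf_pred (p : nat) (x : 'F_p) : prime p -> x != 0 -> x ^+ p.-1 = 1.
Proof.
move=> p_pr nz_x; apply: (mulfI nz_x).
by have := expf_card x; rewrite card_Fp // -exprS prednK ?prime_gt0 // mulr1.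
Qed.

Lemma Fp_prim_root (p : nat) :
  prime p -> exists z : 'F_p, (p.-1).-primitive_root z.
Proof.
move=> p_pr; have p_gt1 := prime_gt1 p_pr.
have /hasP[z _ zP] : has (p.-1).-primitive_root (enum (predC1 (0 : 'F_p))).
  apply: has_prim_root; rewrite ?enum_uniq //; first by lia.
    apply/allP=> x; rewrite mem_enum => nz_x.
    by rewrite unity_rootE expf_pred.
  by rewrite -cardE cardC1 card_Fp.
by exists z.
Qed.

Lemma prod_map_Cyclotomic (R : nzRingType) (n : nat) : (0 < n)%N ->
  \prod_(d <- divisors n) map_poly intr 'Phi_d = 'X^n - 1 :> {poly R}.
Proof.
move=> n_gt0; rewrite -rmorph_prod prod_Cyclotomic //.
by rewrite rmorphB /= map_polyXn rmorph1.
Qed.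

Lemma Cyclotomic_root_expr (R : comNzRingType) (m : nat) (x : R) :
  (0 < m)%N -> root (map_poly intr 'Phi_m) x -> x ^+ m = 1.
Proof.
move=> m_gt0 /rootP Phi_x.
have := congr1 (horner^~ x) (@prod_map_Cyclotomic R m m_gt0).
rewrite (bigD1_seq m) ?divisors_uniq -?dvdn_divisors //= hornerM Phi_x mul0r.
by rewrite !hornerE => /esym/eqP; rewrite subr_eq0 => /eqP.
Qed.

Lemma prim_root_of_Cyclotomic_root (F : fieldType) (m : nat) (x : F) :
  (0 < m)%N -> m%:R != 0 :> F -> root (map_poly intr 'Phi_m) x ->
  m.-primitive_root x.
Proof.
move=> m_gt0 nz_m Phi_root; have xm1 := Cyclotomic_root_expr m_gt0 Phi_root.
have /rootP Phi_x := Phi_root.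
have [d x_prim d_dvd_m] := prim_order_exists m_gt0 xm1.
have d_gt0 := prim_order_gt0 x_prim.
have [<- //|d_neq_m] := eqVneq d m.
(* Here the order [d] of [x] is a proper divisor of [m]. Since [x ^+ d = 1], [x] is also a root of
   some ['Phi_e] with [e] dividing [d], so that [e != m]. *)
have : (\prod_(e <- divisors d) map_poly intr 'Phi_e).[x] = 0 :> F.
  by rewrite prod_map_Cyclotomic // !hornerE prim_expr_order // subrr.
rewrite horner_prod => /eqP; rewrite prodf_seq_eq0.
move=> /hasP[e /= e_div /eqP Phie_x].
move: e_div; rewrite -dvdn_divisors // => e_dvd_d.
have e_neq_m : e != m.
  apply: contraNneq d_neq_m => e_m.
  by rewrite eqn_dvd d_dvd_m -e_m.
(* [x] is a root of two distinct factors of ['X^m - 1], hence a double root,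
   which the derivative [m * 'X^(m-1)] forbids. *)
have := @prod_map_Cyclotomic F m m_gt0.
rewrite (bigD1_seq m) ?divisors_uniq -?dvdn_divisors //= -big_filter.
rewrite (bigD1_seq e) ?filter_uniq ?divisors_uniq //=; last first.
  by rewrite mem_filter e_neq_m -dvdn_divisors // (dvdn_trans e_dvd_d).
move=> /(congr1 (fun f => f^`().[x])).
rewrite !(derivE, hornerE) Phi_x Phie_x !(mul0r, mulr0, addr0) => /esym/eqP.
rewrite subr0 hornerMn hornerXn /= mulr0 mul0r -mulr_natl mulf_eq0.
rewrite (negPf nz_m) expf_eq0 => /andP[_ /eqP x0].
by move/eqP: xm1; rewrite x0 expr0n eqn0Ngt m_gt0 eq_sym oner_eq0.
Qed.

(** * Arbitrarily large primes congruent to 1 modulo [m] *)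

Lemma Cyclotomic_horner_nonunit (m L : nat) : (0 < m)%N -> (0 < L)%N ->
  exists t : nat, `| ('Phi_m).[(L * t.+1)%N%:Z] |%N <> 1%N.
Proof.
move=> m_gt0 L_gt0; apply: contrapT => /forallNP no_t.
(* If all the values were 1 or -1, [f] would vanish at every positive multiple of [L], which is more
   roots than its size allows. *)
pose f := 'Phi_m ^+ 2 - 1 : {poly int}.
have Phi_size : (1 < size ('Phi_m))%N by rewrite size_Cyclotomic ltnS totient_gt0.
have f_size : (1 < size f)%N.
  have sz : size ('Phi_m ^+ 2) = (size 'Phi_m).*2.-1.
    rewrite expr2 size_monicM ?Cyclotomic_monic ?monic_neq0 ?Cyclotomic_monic //.
    by rewrite addnn.
  by rewrite size_polyDl ?sz ?size_polyN ?size_poly1; lia.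
have nz_f : f != 0 by rewrite -size_poly_gt0; lia.
pose rs := [seq (L * t.+1)%N%:Z | t <- iota 0 (size f)].
have : (size rs < size f)%N.
  apply: max_poly_roots nz_f _ _.
    apply/allP=> _ /mapP[t _ ->]; rewrite rootE !hornerE subr_eq0.
    move/contrapT: (no_t t); set y := _.[_] => y1.
    by rewrite -[y ^+ 2]real_normK ?num_real // -abszE y1 expr1n.
  rewrite map_inj_uniq ?iota_uniq // => s t [] /eqP.
  by rewrite eqn_pmul2l // eqSS => /eqP.
by rewrite size_map size_iota ltnn.
Qed.

Lemma prime_cong1_above (m N : nat) : (0 < m)%N ->
  exists q : nat, [/\ prime q, (N < q)%N & (m %| q.-1)%N].
Proof.
move=> m_gt0.
have L_gt0 : (0 < m * N`!)%N by rewrite muln_gt0 m_gt0 fact_gt0.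
have [t] := @Cyclotomic_horner_nonunit m (m * N`!) m_gt0 L_gt0.
set a : nat := (_ * _)%N => Phi_neq1.
(* The value 0 is not excluded; every prime divides it, so 2 serves. *)
have [q q_pr q_dvd] : exists2 q, prime q & (q %| `|('Phi_m).[a%:Z]|)%N.
  move: Phi_neq1; case: `|_|%N => [|[|n]] // _; first by exists 2%N.
  by exists (pdiv n.+2); rewrite ?pdiv_prime ?pdiv_dvd.
have q_char := pchar_Fp q_pr.
pose x : 'F_q := a%:R.
have Phi_x : root (map_poly intr 'Phi_m) x.
  rewrite rootE -[x]/(a%:Z%:~R) horner_map /= -(dvdz_pcharf q_char).
  by rewrite dvdzE.
have xm1 := Cyclotomic_root_expr m_gt0 Phi_x.
(* As [x ^+ m = 1], [q] cannot divide [a], a multiple of both [m] and [N!]. Hence [q] does not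
   divide [m], so [x] has order exactly [m], and [q] exceeds [N]. *)
have q_ndvd_a : ~~ (q %| a)%N.
  rewrite (dvdn_pcharf q_char); apply: contra_eq_neq xm1 => x0.
  by rewrite /x x0 expr0n eqn0Ngt m_gt0 eq_sym oner_eq0.
have nz_m : m%:R != 0 :> 'F_q.
  rewrite -(dvdn_pcharf q_char); apply: contra q_ndvd_a => q_m.
  by rewrite /a -mulnA dvdn_mulr.
exists q; split=> //.
  rewrite ltnNge; apply: contra q_ndvd_a => q_le_N.
  by rewrite /a -mulnA mulnCA dvdn_mulr // dvdn_fact // prime_gt0.
rewrite (prim_order_dvd (prim_root_of_Cyclotomic_root m_gt0 nz_m Phi_x)).
by rewrite expf_pred // /x -(dvdn_pcharf q_char).
Qed.

(** * Prime factors of the elements of [C k] *)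

Lemma C_pred_dvd (k n : int) (p : nat) :
  C k n -> prime p -> (p%:Z %| n)%Z -> ((p.-1)%:Z %| n - k)%Z.
Proof.
move=> [n_gt n_pow] p_pr p_n.
have [m nkE] : exists m : nat, n - k = m%:Z by exists `|n - k|%N; lia.
have [z z_prim] := Fp_prim_root p_pr.
have nz_z : z != 0.
  apply/eqP=> z0; have /eqP := prim_expr_order z_prim.
  by rewrite z0 expr0n eqn0Ngt (prim_order_gt0 z_prim) eq_sym oner_eq0.
have := n_pow (z : nat)%:Z; rewrite nkE => /eqP; rewrite eqz_mod_dvd.
move=> /(dvdz_trans p_n); rewrite (dvdz_pcharf (pchar_Fp p_pr)).
rewrite -PoszD -exprnP addn1 rmorphB rmorphXn /= -pmulrn natr_Zp.
rewrite subr_eq0 => /eqP zm.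
rewrite dvdzE /= (prim_order_dvd z_prim).
by apply/eqP/(mulfI nz_z); rewrite -exprS mulr1.
Qed.

(** Take [a = p]: since [k < n], the exponent is at least 2, so [p * p] divides the power and would
    then divide [p]. *)
Lemma C_squarefree (k n : int) (p : nat) :
  C k n -> prime p -> ~ ((p * p)%N%:Z %| n)%Z.
Proof.
move=> [n_gt n_pow] p_pr p2_n.
have [m nkE] : exists m : nat, n - k + 1 = m.+2%:Z.
  by exists `|(n - k - 1)%R|%N; lia.
have /eqP := n_pow p%:Z; rewrite nkE eqz_mod_dvd => /(dvdz_trans p2_n).
rewrite -exprnP !exprS mulrA -PoszM rpredBl ?dvdz_mulr //.
rewrite dvdzE /= => /dvdn_leq; rewrite prime_gt0 // => /(_ isT).
by have := prime_gt1 p_pr; nia.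
Qed.

(** A cofactor [m > 1] of [p * q] in [n] would have a prime factor among [p] and [q], whose square
    would then divide [n]. *)
Lemma C_two_prime_factorsE (k n : int) : C k n -> two_prime_factors n ->
  exists p q : nat, [/\ prime p, prime q, (p < q)%N & n = (p * q)%N%:Z].
Proof.
move=> n_C; rewrite /two_prime_factors /=.
have n_gt0 : 0 < n by case: n_C; lia.
have nE : n = `|n|%N by lia.
have absn_gt0 : (0 < `|n|)%N by lia.
have := sorted_primes `|n|%N; have mem := mem_primes _ `|n|%N.
case primesE : (primes `|n|%N) mem => [|p [|q []]] //= mem /andP[p_lt_q _] _.
have /and3P[p_pr _ p_n] : [&& prime p, (0 < `|n|)%N & (p %| `|n|)%N].
  by rewrite -mem !inE eqxx.
have /and3P[q_pr _ q_n] : [&& prime q, (0 < `|n|)%N & (q %| `|n|)%N].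
  by rewrite -mem !inE eqxx orbT.
exists p, q; split=> //; rewrite nE; congr Posz.
have co_pq : coprime p q by rewrite prime_coprime // dvdn_prime2 //; lia.
have /dvdnP[m nm] : (p * q %| `|n|)%N by rewrite Gauss_dvd // p_n.
have [m1|m_neq1] := eqVneq m 1%N; first by rewrite nm m1 mul1n.
have r_pr : prime (pdiv m) by rewrite pdiv_prime; lia.
exfalso; apply: (C_squarefree n_C r_pr); rewrite dvdzE /= nm.
have : pdiv m \in [:: p; q].
  by rewrite mem r_pr absn_gt0 nm dvdn_mulr // pdiv_dvd.
rewrite !inE => r_pq; apply: dvdn_mul; first exact: pdiv_dvd.
by case/orP: r_pq => /eqP ->; [apply: dvdn_mulr | apply: dvdn_mull].
Qed.

(** * Finiteness when the smaller prime is not [k] *)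

Lemma C_semiprime_bound (k : int) (p q : nat) :
  prime p -> prime q -> (p < q)%N -> p%:Z <> k -> C k (p * q)%N%:Z ->
  (q <= 3 * `|k| + 4)%N.
Proof.
move=> p_pr q_pr p_lt_q p_neq_k pq_C.
have p_gt1 := prime_gt1 p_pr; have q_gt1 := prime_gt1 q_pr.
have := C_pred_dvd pq_C p_pr; rewrite PoszM dvdz_mulr //.
have := C_pred_dvd pq_C q_pr; rewrite PoszM dvdz_mull //.
move=> /(_ isT) /dvdzP[c cE] /(_ isT) /dvdzP[d dE].
have le_dvd (m : nat) (x y : int) : x = y * m%:Z -> x <> 0 -> m%:Z <= `|x|.
  move=> xE nz_x; rewrite -abszE lez_nat dvdn_leq //; first by lia.
  by rewrite xE abszM dvdn_mull.
(* Modulo [q - 1], [p * q - k] reduces to [p - k], which is nonzero; [u] is the quotient of [p - k]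
   by [q - 1]. *)
pose u := c - p%:Z.
have uE : p%:Z - k = u * q.-1%:Z by rewrite mulrBl -cE; lia.
have q_le : q.-1%:Z <= `|p%:Z - k| by apply: le_dvd uE _; lia.
(* For [k > 0], [q_le] forces [p < k] and then [q <= k].  For [k <= 0], either
   [u >= 2], or [u = 1] and [p - 1] divides [2 (1 - k)]. *)
have [k_gt0|k_le0] := ltP 0 k; first by lia.
have [u2|u_lt2] := leP 2 u.
  have : 2 * q.-1%:Z <= u * q.-1%:Z by rewrite ler_wpM2r.
  by lia.
have u1 : u = 1.
  have : 0 < u * q.-1%:Z by rewrite -uE; lia.
  by rewrite pmulr_lgt0; lia.
rewrite u1 mul1r in uE.
(* Now [q = p + |k| + 1], and [p * q - k] reduces to [2 - 2 * k] modulo [p - 1]. So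
   [p <= 2 * |k| + 3], whence the constant [3 * |k| + 4]. *)
have vE : 2 - 2 * k = (d - q%:Z - 1) * p.-1%:Z by rewrite !mulrBl -dE; lia.
have : p.-1%:Z <= `|2 - 2 * k| by apply: le_dvd vE _; lia.
by lia.
Qed.

Lemma finite_set_int_bounded (A : set int) (B : nat) :
  (forall n, A n -> 0 <= n <= B%:Z) -> finite_set A.
Proof.
move=> A_B; apply: (@sub_finite_set _ _ (Posz @` `I_B.+1)).
  by move=> n /A_B n_B; exists `|n|%N; rewrite /=; lia.
exact/finite_image/finite_II.
Qed.

(** Only the smaller prime must differ from [k], so this serves both for primes coprime to [k] and
    for every [k] that is not a positive prime. *)
Lemma finite_C_semiprime (k : int) :
  finite_set (C k `&` [set n : int | exists p q : nat,
    [/\ prime p, prime q, (p < q)%N, p%:Z <> k & n = (p * q)%N%:Z]]).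
Proof.
pose b := (3 * `|k| + 4)%N.
apply: (@finite_set_int_bounded _ (b * b)%N).
move=> n [n_C [p [q [p_pr q_pr p_lt_q p_neq_k nE]]]].
rewrite nE in n_C *.
have := @C_semiprime_bound k p q p_pr q_pr p_lt_q p_neq_k n_C; rewrite -/b => q_b.
have : (p * q <= b * b)%N by rewrite leq_mul //; lia.
by lia.
Qed.

(** * The infinite family for prime [k] *)

Lemma expz_mod_prime (p e : nat) (a : int) : prime p -> (p.-1 %| e)%N ->
  (p%:Z %| a ^+ e.+1 - a)%Z.
Proof.
move=> p_pr /dvdnP[m ->].
rewrite (dvdz_pcharf (pchar_Fp p_pr)) rmorphB rmorphXn /= subr_eq0.
have [->|nz_a] := eqVneq (a%:~R : 'F_p) 0; first by rewrite expr0n.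
by rewrite exprS mulnC exprM expf_pred // expr1n mulr1.
Qed.

(** The exponent is [k * (q - 1) + 1], and [k * (q - 1)] is a multiple of both [q - 1] and [k - 1]:
    Fermat's little theorem applies modulo each prime. *)
Lemma C_prime_mul (k q : nat) : prime k -> prime q -> (k < q)%N ->
  (k.-1 %| q.-1)%N -> C k%:Z (k * q)%N%:Z.
Proof.
move=> k_pr q_pr k_lt_q k1_q1.
have k_gt1 := prime_gt1 k_pr.
split=> [|a]; first by nia.
have -> : (k * q)%N%:Z - k%:Z + 1 = (k * q.-1).+1%:Z by nia.
apply/eqP; rewrite eqz_mod_dvd -exprnP PoszM Gauss_dvdz; last first.
  by rewrite coprimezE /= prime_coprime // dvdn_prime2 //; lia.
by rewrite !expz_mod_prime // ?dvdn_mull.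
Qed.

Theorem theorem5p1 (k : int) :
  (infinite_set (C k `&` two_prime_factors) <-> (0 < k /\ prime `|k|%N)) /\
  finite_set (C k `&`
    [set n : int | exists p q : nat,
       [/\ prime p, prime q, p <> q, coprimez p%:Z k /\ coprimez q%:Z k
         & n = p%:Z * q%:Z]]) /\
  ((k < 0 \/ (0 < k /\ ~ prime `|k|%N)) ->
   finite_set (C k `&` two_prime_factors `&`
     [set n : int | exists p : nat,
        [/\ prime p, (p%:Z %| n)%Z & (p%:Z %| k)%Z]])).
Proof.
(* Neither prime factor can equal [k] here. This yields one direction of the equivalence, by
   contraposition, and also the last claim. *)
have fin_nonprime : ~ (0 < k /\ prime `|k|%N) ->
    finite_set (C k `&` two_prime_factors).
  move=> k_nonprime; apply: sub_finite_set (finite_C_semiprime k) => n [n_C n_2].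
  have [p [q [p_pr q_pr p_lt_q nE]]] := @C_two_prime_factorsE _ _ n_C n_2.
  split=> //; exists p, q; split=> // pk.
  by apply: k_nonprime; rewrite -pk; split=> //; have := prime_gt0 p_pr; lia.
split; [split|split].
- by move=> k_inf; apply: contrapT => /fin_nonprime.
- move=> [k_gt0 k_pr] /finite_seqP[s sE].
  have k1_gt0 : (0 < `|k|.-1)%N by have := prime_gt1 k_pr; lia.
  (* [q] is taken beyond every element of the supposed finite list [s], so [k * q] cannot occur in
     it. *)
  have [q [q_pr q_gt q_cong]] :=
    @prime_cong1_above _ (maxn `|k| (\max_(n <- s) `|n|)%N) k1_gt0.
  move: q_gt; rewrite gtn_max => /andP[k_lt_q s_lt_q].
  have : (C k `&` two_prime_factors) (`|k| * q)%N%:Z.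
    split.
      by rewrite -[k in C k]gez0_abs ?(ltW k_gt0) //; apply: C_prime_mul.
    apply: (@perm_size _ _ [:: `|k|%N; q]); apply: uniq_perm.
    - exact: primes_uniq.
    - by rewrite /= inE andbT ltn_eqF.
    by move=> p; rewrite primesM ?prime_gt0 // !primes_prime // !inE.
  rewrite sE /= => kq_s.
  have := @leq_bigmax_seq _ s xpredT (fun n : int => `|n|%N) _ kq_s isT.
  rewrite /= leqNgt => /negP[]; apply: leq_trans s_lt_q _.
  by rewrite leq_pmull // prime_gt0.
- apply: sub_finite_set (finite_C_semiprime k).
  have p_neq p : prime p -> coprimez p%:Z k -> p%:Z <> k.
    move=> p_pr cop pk; move: cop; rewrite -pk coprimezE /= /coprime gcdnn.
    by move=> /eqP p1; rewrite p1 in p_pr.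
  move=> n [n_C [p [q [p_pr q_pr /eqP p_neq_q [cop coq] nE]]]]; split=> //.
  move: p_neq_q; rewrite neq_ltn => /orP[p_lt_q|q_lt_p].
    by exists p, q; split=> //; exact: p_neq.
  by exists q, p; split=> //; [exact: p_neq | rewrite nE mulrC].
- move=> k_cond; apply: finite_setIl; apply: fin_nonprime.
  by case: k_cond => [k_lt0 []|[_ ?] []] //; lia.
Qed.
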